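(* Let $G$ be a finite group with identity $e$, let $S$ be an inverse-closed subset of $G\setminus\{e\}$, and let $\Gamma=\mathrm{Cay}(G,S)$ be a connected $|S|$-regular graph, where $|S|\geq3$ and $S$ is closed under conjugation (that is, $g^{-1}sg\in S$ for all $s\in S$ and $g\in G$). Then $\Gamma$ contains no $(1,|S|)$-regular set.
   Context: The Cayley graph $\mathrm{Cay}(G,S)$ is the simple graph with vertex set $G$ in which $y$ and $z$ are adjacent if and only if $y^{-1}z\in S$. For a graph $\Gamma$ and nonnegative integers $a,b$, a nonempty proper subset $C$ of $V(\Gamma)$ is an $(a,b)$-regular set of $\Gamma$ if every vertex in $C$ has exactly $a$ neighbours in $C$ and every vertex in $V(\Gamma)\setminus C$ has exactly $b$ neighbours in $C$. *)

(* Defs.v *)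
From mathcomp Require Import all_boot all_fingroup.

Set Implicit Arguments.
Unset Strict Implicit.
Unset Printing Implicit Defensive.

Local Open Scope group_scope.

(* A simple graph on V is a symmetric irreflexive relation on V. *)

Definition neighbours (V : finType) (e : rel V) (x : V) : {set V} :=
  [set y | e x y].

Definition connected_graph (V : finType) (e : rel V) : Prop :=
  forall x y : V, connect e x y.

Definition regular_graph (V : finType) (e : rel V) (k : nat) : Prop :=
  forall x : V, #|neighbours e x| = k.

Definition regular_set (V : finType) (e : rel V) (a b : nat) (C : {set V}) :
    Prop :=
  [/\ C != set0,
      C \proper [set: V],
      forall x : V, x \in C -> #|neighbours e x :&: C| = a
    & forall x : V, x \notin C -> #|neighbours e x :&: C| = b].

Definition Cay (gT : finGroupType) (S : {set gT}) : rel gT :=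
  fun y z => y^-1 * z \in S.

Lemma Cay_irreflexive (gT : finGroupType) (S : {set gT}) :
  1 \notin S -> irreflexive (Cay S).
Proof. by move=> S1 x; rewrite /Cay mulVg; apply: negbTE. Qed.

Lemma Cay_symmetric (gT : finGroupType) (S : {set gT}) :
  (forall s, s \in S -> s^-1 \in S) -> symmetric (Cay S).
Proof.
move=> SV; have sub y z : Cay S y z -> Cay S z y.
  by rewrite /Cay => /SV; rewrite invMg invgK.
by move=> y z; apply/idP/idP; apply: sub.
Qed.

(* Main.v *)
Require Import Defs.
From mathcomp Require Import all_boot all_fingroup.

(** Let [x] be a vertex of a [(1, |S|)]-regular set [C], and let [x * s] be its
    only neighbour in [C]. For any other [t] in [S] the vertex [x * t] is
    outside [C], so all of its neighbours lie in [C]; in particular [x * t * s]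
    does. Normality of [S] enters here: [x * t * s = (x * s) * (t ^ s)] is also
    a neighbour of [x * s]. But [x * s] lies in [C], and its only neighbour
    there is [x], so [x * t * s = x], that is, [t = s^-1]. Thus [S] is contained
    in the set of [s] and [s^-1], which contradicts [3 <= #|S|]. *)

Set Implicit Arguments.
Unset Strict Implicit.
Unset Printing Implicit Defensive.

Local Open Scope group_scope.

Lemma Cay_mulr (gT : finGroupType) (S : {set gT}) (x s : gT) :
  Cay S x (x * s) = (s \in S).
Proof. by rewrite /Cay mulKg. Qed.

Lemma card1_neighbours_unique (V : finType) (e : rel V) (C : {set V})
    (x y z : V) :
  #|neighbours e x :&: C| = 1%N ->
  e x y -> y \in C -> e x z -> z \in C -> y = z.
Proof.
move=> /eqP/cards1P[w Ew] exy yC exz zC.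
have: y \in neighbours e x :&: C by rewrite !inE exy.
have: z \in neighbours e x :&: C by rewrite !inE exz.
by rewrite Ew => /set1P-> /set1P->.
Qed.

(** The value [#|S|] is the full degree in a Cayley graph, so a vertex with that
    many neighbours in [C] has no neighbour elsewhere. *)
Lemma Cay_full_neighbours (gT : finGroupType) (S C : {set gT}) (x s : gT) :
  #|neighbours (Cay S) x :&: C| = #|S| -> s \in S -> x * s \in C.
Proof.
move=> cardC sS.
have cardN : #|neighbours (Cay S) x| = #|S|.
  rewrite -(card_lcoset S x); congr #|pred_of_set _|; apply/setP=> y.
  by rewrite inE mem_lcoset.
have /setIidPl/subsetP NC : neighbours (Cay S) x :&: C = neighbours (Cay S) x.
  by apply/eqP; rewrite eqEcard subsetIl cardN cardC leqnn.
by apply: NC; rewrite inE Cay_mulr.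
Qed.

Theorem theorem5p1 (gT : finGroupType) (S : {set gT})
    (S_id : 1 \notin S)
    (S_inv : forall s : gT, s \in S -> s^-1 \in S)
    (Cay_connected : connected_graph (Cay S))
    (Cay_regular : regular_graph (Cay S) #|S|)
    (S_card : (3 <= #|S|)%N)
    (S_conj : forall s g : gT, s \in S -> g^-1 * s * g \in S) :
  ~ exists C : {set gT}, regular_set (Cay S) 1 #|S| C.
Proof.
case=> C [/set0Pn[x xC] _ inC outC].
have /eqP/cards1P[y Ey] := inC x xC.
have: y \in neighbours (Cay S) x :&: C by rewrite Ey set11.
rewrite !inE => /andP[exy yC].
have [s sS yE] : exists2 s, s \in S & y = x * s.
  by exists (x^-1 * y) => //; rewrite mulKVg.
have subS : S \subset [set s; s^-1].
  apply/subsetP=> t tS; rewrite !inE.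
  have [//|t_neq_s] := eqVneq t s.
  have xt_notin : x * t \notin C.
    apply: contra t_neq_s => xtC; apply/eqP/(mulgI x); rewrite -yE.
    by apply: (card1_neighbours_unique (inC x xC)); rewrite ?Cay_mulr.
  have xtsC : x * t * s \in C := Cay_full_neighbours (outC _ xt_notin) sS.
  have y_xts : Cay S y (x * t * s).
    have -> : x * t * s = y * (s^-1 * t * s) by rewrite yE !mulgA mulgK.
    by rewrite Cay_mulr S_conj.
  have y_x : Cay S y x by rewrite Cay_symmetric.
  have xtsE := card1_neighbours_unique (inC y yC) y_xts xtsC y_x xC.
  by rewrite eq_mulgV1 invgK -(inj_eq (mulgI x)) mulgA xtsE mulg1 eqxx.
have := leq_trans S_card (subset_leq_card subS).
by rewrite cards2; case: (s != s^-1).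
Qed.
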